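(* Let $p$ be a prime and let $G$ be a finite potent $p$-group. Then: (a) the non-abelian tensor square $[G,G^{\varphi}]$, viewed as a subgroup of $\nu(G)$, is potently embedded in $\nu(G)$; (b) if $k \geqslant 2$, then the $k$-th term $\gamma_k(\nu(G))$ of the lower central series of $\nu(G)$ is potently embedded in $\nu(G)$.
   Context: Notation: $x^y = y^{-1}xy$ and $[x,y]$ is the group commutator. For a group $G$, let $\varphi: G \to G^{\varphi}$, $g \mapsto g^{\varphi}$, be an isomorphism onto a copy $G^{\varphi}$ of $G$. Define $$\nu(G) = \langle G \cup G^{\varphi} \mid [g_1,g_2^{\varphi}]^{g_3} = [g_1^{g_3},(g_2^{g_3})^{\varphi}] = [g_1,g_2^{\varphi}]^{g_3^{\varphi}},\ g_1,g_2,g_3 \in G\rangle,$$ where the relations of $G$ and of $G^{\varphi}$ are also understood to hold (so $\nu(G)$ is a quotient of the free product $G * G^{\varphi}$). The subgroup $[G,G^{\varphi}]$ of $\nu(G)$, generated by all $[g,h^{\varphi}]$ with $g,h\in G$, is identified with the non-abelian tensor square $G\otimes G$ via $g\otimes h \mapsto [g,h^{\varphi}]$. For a $p$-group $H$ and an integer $m\ge 1$, $H^{m}$ denotes the subgroup generated by all $h^m$, $h \in H$; $H'=\gamma_2(H)=[H,H]$; $\gamma_1(H)=H$ and $\gamma_{k+1}(H)=[\gamma_k(H),H]$. For a subgroup $N$ of $H$, $[N,_{0}H]=N$ and $[N,_{i+1}H]=[[N,_{i}H],H]$. A finite $p$-group $H$ is potent if $p>2$ and $\gamma_{p-1}(H)\leqslant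 H^p$, or $p=2$ and $H'\leqslant H^4$. A subgroup $N$ of a finite $p$-group $H$ is potently embedded in $H$ if $[N,H]\leqslant N^4$ when $p=2$, or $[N,_{p-2}H]\leqslant N^p$ when $p$ is odd. *)

(* Defs.v *)
(* boolp: a presented group is a quotient by an undecidable congruence. *)
From HB Require Import structures.
From mathcomp Require Import all_boot all_fingroup all_solvable.
From mathcomp Require Import boolp.

Set Implicit Arguments.
Unset Strict Implicit.
Unset Printing Implicit Defensive.

Local Open Scope group_scope.
Local Open Scope quotient_scope.

(* Group words over X, taken as raw terms: words carry the operations of a
   group (hence the notations x ^ y and [~ x, y]) but none of its laws. *)
Inductive word (X : Type) : Type :=
| Gen of X
| One
| Mul of word X & word X
| Inv of word X.
Arguments One {X}.

HB.instance Definition _ (X : Type) := gen_eqMixin (word X).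
HB.instance Definition _ (X : Type) := gen_choiceMixin (word X).
HB.instance Definition _ (X : Type) := hasMul.Build (word X) (@Mul X).
HB.instance Definition _ (X : Type) := hasOne.Build (word X) (@One X).
HB.instance Definition _ (X : Type) := hasInv.Build (word X) (@Inv X).

(* The least congruence that contains the relations R and the group laws. *)
Inductive word_eq (X : Type) (R : word X -> word X -> Prop) :
    word X -> word X -> Prop :=
| word_eq_rel u v : R u v -> word_eq R u v
| word_eq_refl u : word_eq R u u
| word_eq_sym u v : word_eq R u v -> word_eq R v u
| word_eq_trans v u w : word_eq R u v -> word_eq R v w -> word_eq R u w
| word_eq_mul u u' v v' :
    word_eq R u u' -> word_eq R v v' -> word_eq R (u * v) (u' * v')
| word_eq_inv u u' : word_eq R u u' -> word_eq R u^-1 u'^-1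
| word_eq_mulA u v w : word_eq R (u * (v * w)) ((u * v) * w)
| word_eq_mul1 u : word_eq R (1 * u) u
| word_eq_mulV u : word_eq R (u^-1 * u) 1.

Section Presented.
Variables (X : Type) (R : word X -> word X -> Prop).

Definition word_eqb : rel (word X) := fun u v => `[< word_eq R u v >].

Lemma word_eqb_refl : reflexive word_eqb.
Proof. by move=> u; apply/asboolP; apply: word_eq_refl. Qed.

Lemma word_eqb_sym : symmetric word_eqb.
Proof. by move=> u v; apply/asboolP/asboolP; apply: word_eq_sym. Qed.

Lemma word_eqb_trans : transitive word_eqb.
Proof.
by move=> v u w /asboolP uv /asboolP vw; apply/asboolP/(word_eq_trans uv vw).
Qed.

Canonical word_equiv := EquivRel word_eqb word_eqb_refl word_eqb_sym
  word_eqb_trans.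

(* The group < X | u = v for all u, v such that R u v >. *)
Definition presented := {eq_quot word_eqb}.

HB.instance Definition _ := Choice.on presented.

Definition presented_pi (u : word X) : presented := \pi_{eq_quot word_eqb} u.

(* Qualified: fingroup redefines repr. *)
Definition presented_mul (x y : presented) : presented :=
  presented_pi (generic_quotient.repr x * generic_quotient.repr y).
Definition presented_one : presented := presented_pi 1.
Definition presented_inv (x : presented) : presented :=
  presented_pi (generic_quotient.repr x)^-1.

Lemma presented_piP u v :
  presented_pi u = presented_pi v <-> word_eq R u v.
Proof.
split=> [uv | uv].
  by move/eqmodP: uv => /asboolP.
by apply/eqmodP/asboolP.
Qed.

Lemma presented_reprK (x : presented) : presented_pi (generic_quotient.repr x) = x.
Proof. exact: reprK. Qed.

Lemma word_eq_repr u : word_eq R (generic_quotient.repr (presented_pi u)) u.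
Proof. by apply/presented_piP; apply: presented_reprK. Qed.

Lemma presented_piM u v :
  presented_pi (u * v) = presented_mul (presented_pi u) (presented_pi v).
Proof.
by apply/presented_piP/word_eq_mul; apply: word_eq_sym; apply: word_eq_repr.
Qed.

Lemma presented_piV u : presented_pi u^-1 = presented_inv (presented_pi u).
Proof.
by apply/presented_piP/word_eq_inv; apply: word_eq_sym; apply: word_eq_repr.
Qed.

Lemma presented_mulA : associative presented_mul.
Proof.
move=> x y z; rewrite -(presented_reprK x) -(presented_reprK y).
rewrite -(presented_reprK z) -!presented_piM.
exact/presented_piP/word_eq_mulA.
Qed.

Lemma presented_mul1 : left_id presented_one presented_mul.
Proof.
move=> x; rewrite -(presented_reprK x) -presented_piM.
exact/presented_piP/word_eq_mul1.
Qed.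

Lemma presented_mulVx : left_inverse presented_one presented_inv presented_mul.
Proof.
move=> x; rewrite -(presented_reprK x) -presented_piV -presented_piM.
exact/presented_piP/word_eq_mulV.
Qed.

Lemma presented_mulxV : right_inverse presented_one presented_inv presented_mul.
Proof.
move=> x; set y := presented_inv x; set z := presented_inv y.
have zy : presented_mul z y = presented_one by apply: presented_mulVx.
have yx : presented_mul y x = presented_one by apply: presented_mulVx.
rewrite -[LHS]presented_mul1 -zy -presented_mulA [presented_mul y _]presented_mulA.
by rewrite yx presented_mul1.
Qed.

Lemma presented_mulx1 : right_id presented_one presented_mul.
Proof.
move=> x; rewrite -(presented_mulVx x) presented_mulA presented_mulxV.
exact: presented_mul1.
Qed.

HB.instance Definition _ := isGroup.Build presented
  presented_mulA presented_mul1 presented_mulx1 presented_mulVx presented_mulxV.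

End Presented.

(* Defining relations of nu(G); inl g stands for the generator g of G and
   inr g for the generator g^phi of the copy G^phi. The first two families
   are the relations of G and of G^phi (multiplication tables). *)
Inductive nu_rel (G : groupType) : word (G + G) -> word (G + G) -> Prop :=
| nu_rel_G (g h : G) :
    nu_rel (Gen (inl (g * h))) (Gen (inl g) * Gen (inl h))
| nu_rel_Gphi (g h : G) :
    nu_rel (Gen (inr (g * h))) (Gen (inr g) * Gen (inr h))
| nu_rel_conjG (g1 g2 g3 : G) :
    nu_rel ([~ Gen (inl g1), Gen (inr g2)] ^ Gen (inl g3))
           [~ Gen (inl (g1 ^ g3)), Gen (inr (g2 ^ g3))]
| nu_rel_conjGphi (g1 g2 g3 : G) :
    nu_rel ([~ Gen (inl g1), Gen (inr g2)] ^ Gen (inr g3))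
           [~ Gen (inl (g1 ^ g3)), Gen (inr (g2 ^ g3))].

Definition nu (G : groupType) : groupType := presented (@nu_rel G).

Definition nu_G (G : groupType) (g : G) : nu G :=
  presented_pi (@nu_rel G) (Gen (inl g)).

Definition nu_Gphi (G : groupType) (g : G) : nu G :=
  presented_pi (@nu_rel G) (Gen (inr g)).

Section PotentGroups.
Variable gT : finGroupType.
Implicit Types H N : {group gT}.

(* The subgroup H^m generated by the m-th powers (not the set of m-th powers,
   and not a direct power). *)
Definition power_subgroup (m : nat) H : {set gT} :=
  <<[set x ^+ m | x in H]>>.

(* [N,_i H] *)
Definition iter_comm (i : nat) N H : {set gT} :=
  iter i (fun B : {set gT} => [~: B, H]) N.

Definition potent (p : nat) H : Prop :=
  p.-group H /\
  (if p == 2 then H^`(1) \subset power_subgroup 4 H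
   else 'L_(p.-1)(H) \subset power_subgroup p H).

Definition potently_embedded (p : nat) N H : Prop :=
  [/\ p.-group H, N \subset H
    & if p == 2 then [~: N, H] \subset power_subgroup 4 N
      else iter_comm (p - 2) N H \subset power_subgroup p N].

End PotentGroups.

Arguments potent {gT} p%_N H%_G.
Arguments potently_embedded {gT} p%_N N%_G H%_G.

(* Main.v *)
(* Let H = nu(G), with G and G^phi embedded as X and Y, let T = [X, Y] and
   U_n = [gamma_n(X), Y]. The identity [[g, h^phi], x^phi] = [[g, h], x^phi]
   gives [U_n, H] <= U_(n+1), so a nilpotent G yields a nilpotent H, and T is
   finite because H acts trivially on the finitely generated factors
   U_n / U_(n+1), whose generators have finite order.
   For p odd, the Hall-Petresco argument (here through polynomial sequences)
   shows that if N <| H and [x, y] is in N, then [x^p, y] lies in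
   N^p [N,_(p-1) H]; for p = 2, [x^4, y] lies in N^4 [N, H]^2 [N, H, H].
   As gamma_(p-1)(G) <= G^p, this puts [T,_(p-2) H] <= U_(p-1) <= [X^p, Y] in
   T^p [T,_(p-1) H], hence in T^p by nilpotency. The same computation gives
   gamma_(p+k)(H) <= gamma_(k+2)(H)^p by induction on k, starting from
   gamma_p(H) <= [H^p, H]; p = 2 is similar, with fourth powers. *)
From HB Require Import structures.
Require Import Defs.
From mathcomp Require Import all_boot all_fingroup all_solvable.
From mathcomp Require Import boolp.

Set Implicit Arguments.
Unset Strict Implicit.
Unset Printing Implicit Defensive.

Local Open Scope group_scope.

(** * Polynomial sequences *)

Section PolynomialSequences.
Variables (gT : finGroupType) (F : nat -> {group gT}).
Hypothesis F_dec : forall i, F i.+1 \subset F i.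
Hypothesis F_comm : forall i j, [~: F i, F j] \subset F (i + j).
Implicit Types (g h : nat -> gT) (i j k n : nat).

Definition diff g n := (g n)^-1 * g n.+1.
(** These are the polynomial sequences of Lazard and Leibman for the filtration [F], with degrees
    shifted by [i]. *)
Definition poly_seq i g := forall k n, iter k diff g n \in F (i + k).

(** Closure under products and commutators is imposed here so that the Leibniz rule can be proved by
    induction; [poly_gen_seq] then shows that nothing new was added, so that polynomial sequences
    form a group. *)
Inductive poly_gen : nat -> (nat -> gT) -> Prop :=
| poly_gen_base i g : poly_seq i g -> poly_gen i g
| poly_gen_weak i g : poly_gen i.+1 g -> poly_gen i g
| poly_gen_mul i g h :
    poly_gen i g -> poly_gen i h -> poly_gen i (fun n => g n * h n)
| poly_gen_inv i g : poly_gen i g -> poly_gen i (fun n => (g n)^-1)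
| poly_gen_comm i j g h :
    poly_gen i g -> poly_gen j h -> poly_gen (i + j) (fun n => [~ g n, h n]).

Lemma poly_gen_leq i j g : i <= j -> poly_gen j g -> poly_gen i g.
Proof.
move/subnK <-; elim: (j - i) => // d IH Eg; apply: IH.
exact: poly_gen_weak.
Qed.

Lemma poly_gen_conj i j g h :
  poly_gen i g -> poly_gen j h -> poly_gen i (fun n => g n ^ h n).
Proof.
move=> Eg Eh; have -> : (fun n => g n ^ h n) = (fun n => g n * [~ g n, h n]).
  by apply/funext=> n; rewrite conjg_mulR.
apply: poly_gen_mul => //; apply: poly_gen_leq (poly_gen_comm Eg Eh).
exact: leq_addr.
Qed.

Lemma poly_gen_mem i g n : poly_gen i g -> g n \in F i.
Proof.
move=> Eg; elim: Eg n => {i g} [i g Pg|i g _ IH|i g h _ IHg _ IHh|i g _ IH|i j g h _ IHg _ IHh] n.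
- by have := Pg 0 n; rewrite addn0.
- exact: (subsetP (F_dec i)).
- by rewrite groupM.
- by rewrite groupV.
- exact: (subsetP (F_comm i j)) (mem_commg _ _).
Qed.

(* The Leibniz rule: unlike polynomial sequences at this stage, the sequences
   in poly_gen are by definition a filtration, so commutators are harmless. *)
Lemma poly_gen_diff i g : poly_gen i g -> poly_gen i.+1 (diff g).
Proof.
elim=> {i g} [i g Pg|i g _ IH|i g h Eg IHg Eh IHh|i g Eg IH|i j g h Eg IHg Eh IHh].
- apply: poly_gen_base => k n; rewrite -iterSr addSnnS; exact: Pg.
- exact: poly_gen_weak.
- have -> : diff (fun n => g n * h n) = (fun n => diff g n ^ h n * diff h n).
    by apply/funext=> n; rewrite /diff /conjg invMg !mulgA mulgK.
  exact: poly_gen_mul (poly_gen_conj IHg Eh) IHh.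
- have -> : diff (fun n => (g n)^-1) = (fun n => (diff g n)^-1 ^ (g n)^-1).
    by apply/funext=> n; rewrite /diff /conjg invMg !invgK !mulgA mulgK.
  exact: poly_gen_conj (poly_gen_inv IH) (poly_gen_inv Eg).
pose a := diff g; pose b := diff h.
have gS n : g n.+1 = g n * a n by rewrite /a /diff mulKVg.
have hS n : h n.+1 = h n * b n by rewrite /b /diff mulKVg.
(* Cancelling [[~ g n, h n]] from the expansion of [[~ g n * a n, h n * b n]] leaves only factors
   that contain an increment [a] or [b], hence of degree at least [(i + j).+1]. *)
have -> : diff (fun n => [~ g n, h n]) = (fun n =>
    ([~ g n, b n] ^ a n * [~ a n, b n]) ^ [~ g n, h n]
    * [~ [~ g n, h n], a n * b n] * [~ a n, h n] ^ b n).
  apply/funext=> n; rewrite {1}/diff gS hS [in LHS]commgMJ !(commMgJ (g n)).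
  rewrite [(_ * [~ a n, h n]) ^ b n]conjMg -conjgM [[~ [~ _, _], _ * _]]commgEl.
  move: (_ * [~ a n, b n]) (_ ^ (a n * b n)) => u v.
  by move: [~ g n, h n] => c; rewrite conjgE -!mulgA (mulKVg c).
have Egh := poly_gen_comm Eg Eh.
have Ea : poly_gen i.+1 a by []; have Eb : poly_gen j.+1 b by [].
refine (poly_gen_mul (poly_gen_mul _ _) _).
- apply: poly_gen_conj Egh; apply: poly_gen_mul.
    by rewrite -addnS; apply: poly_gen_conj (poly_gen_comm Eg Eb) Ea.
  by apply: poly_gen_leq (poly_gen_comm Ea Eb); rewrite -addnS leq_add2r leqnSn.
- have -> : (fun n => [~ [~ g n, h n], a n * b n]) = (fun n =>
      [~ [~ g n, h n], b n] * [~ [~ g n, h n], a n] ^ b n).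
    by apply/funext=> n; rewrite commgMJ.
  apply: poly_gen_mul.
    by apply: poly_gen_leq (poly_gen_comm Egh Eb); rewrite addnS ltnS leq_addr.
  apply: poly_gen_conj Eb.
  by apply: poly_gen_leq (poly_gen_comm Egh Ea); rewrite addnS ltnS leq_addr.
- by apply: poly_gen_conj Eb; apply: (poly_gen_comm Ea Eh).
Qed.

Lemma poly_gen_seq i g : poly_gen i g -> poly_seq i g.
Proof.
move=> Eg k n; apply: poly_gen_mem.
by elim: k => [|k IH]; rewrite ?addn0 // iterS addnS; apply: poly_gen_diff.
Qed.

Lemma poly_seqM i g h :
  poly_seq i g -> poly_seq i h -> poly_seq i (fun n => g n * h n).
Proof. by move=> Pg Ph; apply/poly_gen_seq/poly_gen_mul; apply: poly_gen_base. Qed.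

Lemma poly_seqS i g :
  (forall n, g n \in F i) -> poly_seq i.+1 (diff g) -> poly_seq i g.
Proof.
move=> Fg Pdg [|k] n; first by rewrite addn0.
by rewrite iterSr addnS -addSn.
Qed.

(** By Pascal's rule each difference lowers the binomial index by one, down to a constant
    sequence. *)
Lemma poly_seq_bin k i s : s \in F (i + k) -> poly_seq i (fun n => s ^+ 'C(n, k)).
Proof.
have F_sub a b : F (a + b) \subset F a.
  by elim: b => [|b IH]; rewrite ?addn0 // addnS (subset_trans (F_dec _)).
elim: k i => [|k IH] i Fs.
  apply: poly_seqS => [n|]; first by rewrite groupX // (subsetP (F_sub i 0)).
  have -> : diff (fun n => s ^+ 'C(n, 0)) = fun=> 1.
    by apply/funext=> n; rewrite /diff !bin0 mulVg.
  have D1 j : iter j diff (fun=> 1) = fun=> 1.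
    by elim: j => // j; rewrite iterS => ->; apply/funext=> n; rewrite /diff mulVg.
  by move=> j n; rewrite D1 group1.
apply: poly_seqS => [n|]; first by rewrite groupX // (subsetP (F_sub i k.+1)).
have -> : diff (fun n => s ^+ 'C(n, k.+1)) = fun n => s ^+ 'C(n, k).
  by apply/funext=> n; rewrite /diff binS expgD mulKg.
by apply: IH; rewrite addSnnS.
Qed.

(** For a sequence trivial before [k], the [k]-th difference at 0 is [g k] itself. *)
Lemma poly_seq_first k g :
  poly_seq 0 g -> (forall n, n < k -> g n = 1) -> g k \in F k.
Proof.
suff Dk j d : (forall n, n < j + d -> g n = 1) ->
    iter j diff g d = g (j + d) /\ forall n, n < d -> iter j diff g n = 1.
  move=> Pg g1; have [|] := Dk k 0; first by move=> n; rewrite addn0; apply: g1.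
  by rewrite addn0 => <- _; apply: Pg.
elim: j d => [|j IH] d g1 //; have := IH d.+1; rewrite addnS => /(_ g1)[IHd IH1].
split; first by rewrite iterS /diff IHd IH1 ?invg1 ?mul1g.
by move=> n ltnd; rewrite iterS /diff !IH1 ?ltnS ?mulVg // ltnW.
Qed.

(* Newton interpolation: g n is the product of the s_k ^+ 'C(n, k) for
   suitable s_k in F k, and p divides 'C(p, k) for 0 < k < p. *)
Lemma poly_seq_prime p g : prime p -> poly_seq 0 g -> g 0 = 1 ->
  (forall x, x \in F 0 -> x ^+ p = 1) -> g p \in F p.
Proof.
move=> p_pr Pg g0 Fp.
suff step k : 0 < k <= p -> (forall n, n < k -> g n = 1) -> g p \in F p.
  by apply: (step 1%N); [rewrite (prime_gt0 p_pr) | case].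
move Ed: (p - k)%N => d; elim: d k g Ed Pg {g0} => [|d IH] k g Ed Pg.
  case/andP=> _ le_kp g1.
  have eq_kp: k = p by apply: anti_leq; rewrite le_kp -subn_eq0 Ed.
  by rewrite -eq_kp; apply: poly_seq_first.
case/andP=> k_gt0 _ g1; have lt_kp: k < p by rewrite -subn_gt0 Ed.
have gk := poly_seq_first Pg g1.
(* Dividing by the [k]-th Newton factor makes the sequence trivial at [k] too and keeps its value at
   [p]. *)
pose h n := ((g k)^-1) ^+ 'C(n, k) * g n.
have <- : h p = g p.
  rewrite /h; have /dvdnP[m ->] := prime_dvd_bin p_pr (introT andP (conj k_gt0 lt_kp)).
  have gk0 : (g k)^-1 \in F 0.
    by rewrite groupV; apply: (Pg 0).
  by rewrite mulnC expgM Fp ?expg1n ?mul1g.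
apply: (IH k.+1); rewrite ?lt_kp ?subnS ?Ed //.
  by apply: poly_seqM Pg; apply: poly_seq_bin; rewrite groupV.
move=> n; rewrite ltnS leq_eqVlt => /orP[/eqP-> | ltnk].
  by rewrite /h binn expg1 mulVg.
by rewrite /h bin_small // (g1 n) // mulg1.
Qed.

End PolynomialSequences.

(** * Commutators with powers *)

Lemma iter_comm_group_set (gT : finGroupType) i (N H : {group gT}) :
  group_set (iter_comm i N H).
Proof. by case: i => [|i]; apply: groupP. Qed.

Canonical iter_comm_group (gT : finGroupType) i (N H : {group gT}) :=
  Group (iter_comm_group_set i N H).
Canonical power_subgroup_group (gT : finGroupType) m (H : {group gT}) :=
  Eval hnf in [group of power_subgroup m H].

Section IteratedCommutators.
Variable gT : finGroupType.
Implicit Types (A B C K M N H : {group gT}) (x y c : gT).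

Lemma three_subgroup_sub A B C K :
    A \subset 'N(K) -> B \subset 'N(K) -> C \subset 'N(K) ->
  [~: B, C, A] \subset K -> [~: C, A, B] \subset K -> [~: A, B, C] \subset K.
Proof.
move=> nKA nKB nKC sBCA sCAB.
have quo3 (D E G : {group gT}) : D \subset 'N(K) -> E \subset 'N(K) -> G \subset 'N(K) ->
    ([~: D, E, G] \subset K) = ([~: D / K, E / K, G / K] == 1).
  move=> nKD nKE nKG.
  have nKDE : [~: D, E] \subset 'N(K) by rewrite comm_subG.
  have nKDEG : [~: D, E, G] \subset 'N(K) by rewrite comm_subG.
  by rewrite -!quotientR // -subG1 quotient_sub1.
rewrite quo3 //; apply/eqP/three_subgroup; apply/eqP; rewrite -quo3 //.
Qed.

Lemma iter_commS i N H : iter_comm i.+1 N H = [~: iter_comm i N H, H].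
Proof. by []. Qed.

Lemma iter_comm_norm i N H : H \subset 'N(N) -> H \subset 'N(iter_comm i N H).
Proof. by case: i => [|i] // _; rewrite iter_commS commg_normr. Qed.

Lemma iter_comm_subS i N H :
  H \subset 'N(N) -> iter_comm i.+1 N H \subset iter_comm i N H.
Proof. by move=> nNH; rewrite iter_commS commg_subl iter_comm_norm. Qed.

Lemma iter_comm_sub i N H : H \subset 'N(N) -> iter_comm i N H \subset N.
Proof.
by move=> nNH; elim: i => // i; apply: subset_trans (iter_comm_subS i nNH).
Qed.

(** If [iter_comm a N H] has weight [a.+1], weights add under commutators; the induction on [b] is
    the three subgroups lemma. *)
Lemma iter_comm_sub_comm a b N H : N <| H ->
  [~: iter_comm a N H, iter_comm b N H] \subset iter_comm (a + b).+1 N H.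
Proof.
case/andP=> sNH nNH; have nK i : H \subset 'N(iter_comm i N H).
  exact: iter_comm_norm.
have sK i : iter_comm i N H \subset H by rewrite (subset_trans (iter_comm_sub i _)).
elim: b a => [|b IHb] a; first by rewrite addn0 iter_commS commgS.
rewrite (iter_commS b) commGC.
have nKK i j : iter_comm i N H \subset 'N(iter_comm j N H).
  exact: subset_trans (sK i) (nK j).
apply: three_subgroup_sub (nKK _ _) (nK _) (nKK _ _) _ _ => /=.

  by rewrite (commGC H) -iter_commS addnS -addSn; apply: IHb.
by rewrite addnS commSg //; apply: IHb.
Qed.

Lemma power_subgroupP m N x : x \in N -> x ^+ m \in power_subgroup m N.
Proof. by move=> Nx; rewrite mem_gen //; apply: imset_f. Qed.

Lemma power_subgroup_sub m N : power_subgroup m N \subset N.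
Proof. by rewrite gen_subG; apply/subsetP=> _ /imsetP[x Nx ->]; rewrite groupX. Qed.

Lemma power_subgroup_norm m N H :
  H \subset 'N(N) -> H \subset 'N(power_subgroup m N).
Proof.
move=> nNH; apply: norms_gen; apply/subsetP=> h Hh; rewrite inE.
apply/subsetP=> _ /imsetP[_ /imsetP[x Nx ->] ->].
by rewrite conjXg; apply: imset_f; rewrite memJ_norm // (subsetP nNH).
Qed.

(** The sequence x^-n (x c)^n is polynomial with values in [N] and trivial at 0, so [poly_seq_prime]
    puts its value at [p] in [N,_(p-1) H] = 1. *)
Lemma expMg_prime p N H x c : prime p -> N <| H -> x \in H -> c \in N ->
    (forall z, z \in N -> z ^+ p = 1) -> iter_comm p.-1 N H = 1 ->
  (x * c) ^+ p = x ^+ p.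
Proof.
move=> p_pr nsNH Hx Nc Np Hp; have [sNH nNH] := andP nsNH.
(* The predecessor makes [F 0] and [F 1] both equal to [N]: elements of [N] have weight 1, and [F p]
   is [iter_comm p.-1 N H]. *)
pose F i := iter_comm_group i.-1 N H.
have nF i : H \subset 'N(F i) by exact: iter_comm_norm.
have sF i : F i \subset H by rewrite (subset_trans (iter_comm_sub _ _)).
have F_dec i : F i.+1 \subset F i by case: i => // i; apply: iter_comm_subS.
have F_comm i j : [~: F i, F j] \subset F (i + j).
  case: i => [|i]; first by rewrite commg_subr (subset_trans (sF 0)).
  case: j => [|j]; first by rewrite addn0 commg_subl (subset_trans (sF 0)).
  by rewrite addSn addnS; apply: iter_comm_sub_comm.
have F_commH i : [~: F i, H] \subset F i.+1.
  by case: i => [|i] //=; rewrite commg_subl.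
set y := x * c; have Hy : y \in H by rewrite groupM // (subsetP sNH).
(* Each difference replaces [s] by [[~ s, y]], one step further down the filtration. *)
have conj_poly i s : s \in F i -> poly_seq F i (fun n => s ^ (y ^+ n)).
  move=> Fs k; elim: k i s Fs => [|k IH] i s Fs n.
    by rewrite addn0 /= memJ_norm // (subsetP (nF i)) ?groupX.
  have dE : diff (fun n => s ^ (y ^+ n)) = fun n => [~ s, y] ^ (y ^+ n).
    by apply/funext=> m; rewrite /diff expgS conjgM -conjVg -conjMg.
  rewrite iterSr dE -addSnnS; apply: IH.
  by rewrite (subsetP (F_commH i)) ?mem_commg.
pose g n := (x ^+ n)^-1 * y ^+ n.
have gS n : g n.+1 = g n * c ^ (y ^+ n).
  by rewrite /g !expgS invMg {2}/y !mulgA mulgK mulgKV.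
have Pg : poly_seq F 0 g.
  apply: poly_seqS => [n|].
    elim: n => [|n IH]; first by rewrite /g mulVg group1.
    by rewrite gS groupM // memJ_norm // (subsetP nNH) ?groupX.
  have -> : diff g = fun n => c ^ (y ^+ n).
    by apply/funext=> n; rewrite /diff gS mulKg.
  exact: conj_poly.
have := poly_seq_prime F_dec F_comm p_pr Pg (mulVg _) Np.
by rewrite /= Hp => /set1P/(canRL (mulKVg _)); rewrite mulg1.
Qed.
End IteratedCommutators.

Lemma quotient_iter_comm (gT : finGroupType) i (N H M : {group gT}) :
    N \subset H -> H \subset 'N(N) -> H \subset 'N(M) ->
  iter_comm i N H / M = iter_comm i (N / M) (H / M).
Proof.
move=> sNH nNH nMH; elim: i => // i IH; rewrite !iter_commS quotientR ?IH //.
by rewrite (subset_trans (iter_comm_sub i nNH)) // (subset_trans sNH).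
Qed.

Section PowerCommutators.
Variable gT : finGroupType.
Implicit Types (A B C K M N H : {group gT}) (x y c : gT).

(** With c = [x, y], the commutator is x^-p (x c)^p, which [expMg_prime] kills modulo the subgroup
    on the right. *)
Lemma commXg_prime p N H x y : prime p -> N <| H -> x \in H -> y \in H ->
  [~ x, y] \in N ->
  [~ x ^+ p, y] \in power_subgroup p N <*> iter_comm p.-1 N H.
Proof.
move=> p_pr nsNH Hx Hy Nxy; have [sNH nNH] := andP nsNH.
set M := _ <*> _; have nMH : H \subset 'N(M).
  by rewrite normsY ?power_subgroup_norm ?iter_comm_norm.
have nM z : z \in H -> z \in 'N(M) by apply/subsetP.
apply: coset_idr; first by rewrite nM ?groupR ?groupX.
rewrite commgEl conjXg conjg_mulR.
have Hxy : [~ x, y] \in H by rewrite groupR.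
move: [~ x, y] Hxy Nxy => c Hc Nc.
rewrite morphM ?morphV ?morphX ?morphM ?nM ?groupV ?groupX ?groupM //.
rewrite (@expMg_prime _ p (N / M)%G (H / M)%G) ?mulVg ?quotient_normal ?mem_quotient //.
  move=> _ /morphimP[z nMz Nz ->]; rewrite -morphX //; apply: coset_id.
  by rewrite mem_gen // inE power_subgroupP.
rewrite -quotient_iter_comm //; apply/trivgP.
by rewrite quotient_sub1 ?joing_subr // (subset_trans (iter_comm_sub _ nNH)) // (subset_trans sNH).
Qed.

(** Put c = [x, y] and d = [c, x]. Modulo the subgroup on the right, d commutes with x and c, so (x
    c)^4 = x^4 c^4 d^6 as in class 2. *)
Lemma commXg_four N H x y : N <| H -> x \in H -> y \in H -> [~ x, y] \in N ->
  [~ x ^+ 4, y] \in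
    power_subgroup 4 N <*> (power_subgroup 2 (iter_comm_group 1 N H) <*> iter_comm 2 N H).
Proof.
move=> nsNH Hx Hy Nxy; have [sNH nNH] := andP nsNH.
set M := _ <*> _; have nMH : H \subset 'N(M).
  by rewrite !normsY ?power_subgroup_norm ?iter_comm_norm.
have nM z : z \in H -> z \in 'N(M) by apply/subsetP.
apply: coset_idr; first by rewrite nM ?groupR ?groupX.
set c := [~ x, y] in Nxy; have Hc : c \in H by rewrite (subsetP sNH).
have N1d : [~ c, x] \in iter_comm_group 1 N H by rewrite mem_commg.
have M1 z : z \in H -> [~ z, [~ c, x]] \in M.
  move=> Hz; rewrite -groupV invg_comm mem_gen // inE orbC mem_gen // inE orbC.
  by rewrite iter_commS mem_commg.
have cd z : z \in H -> commute (coset M z) [~ coset M c, coset M x].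
  move=> Hz; apply/commgP; rewrite -!morphR ?nM ?groupR //.
  exact/eqP/coset_id/M1.
have c4 : coset M c ^+ 4 = 1.
  rewrite -morphX ?nM //; apply: coset_id.
  by rewrite mem_gen // inE power_subgroupP.
(* The exponent 6 is 'C(4, 2); it is even, and squares of elements of [N, H] lie in [M]. *)
have d6 : [~ coset M c, coset M x] ^+ 6 = 1.
  rewrite (expgM _ 2 3) -morphR ?nM // -morphX ?nM ?groupR //.
  rewrite [X in X ^+ 3]coset_id ?expg1n //.
  by rewrite mem_gen // inE orbC mem_gen // inE power_subgroupP.
rewrite commgEl conjXg conjg_mulR -/c; move: c Hc c4 d6 cd {N1d M1 Nxy} => c Hc c4 d6 cd.
rewrite morphM ?morphV ?morphX ?morphM ?nM ?groupV ?groupX ?groupM //.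
rewrite expMg_Rmul; [|exact: cd|exact: cd].
by rewrite c4 d6 !mulg1 mulVg.
Qed.

(** Modulo [M], the p-th powers lie in the Frattini subgroup of N/M and are non-generators, so N/M =
    [N/M, H/M]; nilpotency then forces N/M = 1. *)
Lemma sub_mod_power_comm (p : nat) M N H : p.-group H -> N <| H -> H \subset 'N(M) ->
  N \subset M <*> (power_subgroup p N <*> [~: N, H]) -> N \subset M.
Proof.
move=> pH /andP[sNH nNH] nMH sN.
have nMN := subset_trans sNH nMH.
rewrite -quotient_sub1 //; apply/trivgP/eqP/negPn/negP=> ntN.
have nMR : [~: N, H] \subset 'N(M) by rewrite comm_subG.
have nMP : power_subgroup p N \subset 'N(M).
  by rewrite (subset_trans (power_subgroup_sub _ _)).
have pHM : p.-group (H / M) := quotient_pgroup _ pH.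
have sNHM := quotientS M sNH.
have pNM : p.-group (N / M) := pgroupS sNHM pHM.
have : [~: N / M, H / M] \proper N / M.
  apply: (nil_comm_properl (pgroup_nil pHM)) => //.
  by rewrite subsetI subxx quotient_norms.
rewrite properE => /andP[sRN]; case/negP.
suff /Phi_nongen eqN : 'Phi(N / M) <*> [~: N / M, H / M] = N / M.
  by rewrite -{1}eqN genGid.
apply/eqP; rewrite eqEsubset join_subG Phi_sub sRN /=.
have := quotientS M sN; rewrite quotientYidl ?join_subG ?nMP //.
rewrite quotientY // -quotientR // => /subset_trans-> //.
rewrite quotientR // genS // setSU //.
rewrite quotient_gen; last exact: subset_trans (subset_gen _) nMP.
rewrite gen_subG; apply/subsetP=> _ /morphimP[_ _ /imsetP[x Nx ->] ->].
rewrite morphX ?(subsetP nMN) //= (Phi_joing pNM) mem_gen // inE orbC.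
rewrite -(expn1 p) (Mho_p_elt 1) ?mem_quotient //.
exact: mem_p_elt pNM (mem_quotient _ Nx).
Qed.
End PowerCommutators.

(** * Tensor identities *)

(** The relations of nu(G) as conditions on two maps into any group, so that they serve both the
    presented group and its finite model. *)
Definition nu_pair (G V : groupType) (i j : G -> V) : Prop :=
  [/\ {morph i : g h / g * h}, {morph j : g h / g * h},
      forall g h k, [~ i g, j h] ^ i k = [~ i (g ^ k), j (h ^ k)]
    & forall g h k, [~ i g, j h] ^ j k = [~ i (g ^ k), j (h ^ k)]].

Section TensorIdentities.
Variables G V : groupType.
Implicit Types (i j : G -> V) (g h k x y : G).

Lemma nu_pair_sym i j : nu_pair i j -> nu_pair j i.
Proof.
case=> iM jM ci cj; split=> // g h k;
  by rewrite -[[~ j g, i h]]invgR -[[~ j _, i (h ^ k)]]invgR conjVg (ci, cj).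
Qed.

Variables i j : G -> V.
Hypothesis nu_ij : nu_pair i j.

Lemma nu_pair1 : i 1 = 1.
Proof. by case: nu_ij => iM _ _ _; apply: (mulgI (i 1)); rewrite -iM !mulg1. Qed.

Lemma nu_pairV g : i g^-1 = (i g)^-1.
Proof.
case: nu_ij => iM _ _ _; apply/esym/mulg1_eq.
by rewrite -iM mulgV nu_pair1.
Qed.

Lemma nu_pairJ g h : i (g ^ h) = i g ^ i h.
Proof. by case: nu_ij => iM _ _ _; rewrite /conjg !iM nu_pairV. Qed.

Lemma nu_pairR g h : i [~ g, h] = [~ i g, i h].
Proof.
by case: nu_ij => iM _ _ _; rewrite !commgEl iM nu_pairJ nu_pairV.
Qed.

Lemma nu_pairX g n : i (g ^+ n) = i g ^+ n.
Proof.
case: nu_ij => iM _ _ _.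
by elim: n => [|n IH]; rewrite ?nu_pair1 // !expgS iM IH.
Qed.
End TensorIdentities.

(* commMgJ and commgMJ in the library are for finite groups only. *)
Lemma group_commMgJ (V : groupType) (x y z : V) :
  [~ x * y, z] = [~ x, z] ^ y * [~ y, z].
Proof. by rewrite !commgEr conjgM mulgA -conjMg mulgK. Qed.

Lemma group_commgMJ (V : groupType) (x y z : V) :
  [~ x, y * z] = [~ x, z] * [~ x, y] ^ z.
Proof. by rewrite !commgEl conjgM -mulgA -conjMg mulKVg. Qed.

(** As [i k] and [j k] act alike on tensors, the tensor [[~ i g, j h]] acts on them as [i [~ g, h]]
    does. Both sides then become t^-1 u^-1 t w. *)
Lemma tensor_commE (G V : groupType) (i j : G -> V) g h x : nu_pair i j ->
  [~ [~ i g, j h], j x] = [~ i [~ g, h], j x].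
Proof.
move=> nu_ij; have [iM jM ci cj] := nu_ij; have nu_ji := nu_pair_sym nu_ij.
set t := [~ i g, j h]; pose u := [~ i g, j x]; pose w := [~ i (g ^ h), j x].
(* Both sides come from expanding [[~ i g, j (h * x)]], once as written and once with h x = x^(h^-1)
   h. *)
have tx : t ^ j x = u^-1 * (t * w).
  apply: (mulgI u); rewrite mulVKg -[u * _]group_commgMJ -jM.
  by rewrite (conjgCV h x) jM group_commgMJ cj conjgKV.
have ut : u ^ t = u ^ i [~ g, h].
  have tE : t = i g^-1 * (j h^-1 * (i g * j h)).
    by rewrite (nu_pairV nu_ij) (nu_pairV nu_ji).
  by rewrite ci tE !conjgM !(ci, cj) -!conjgM.
have uE : [~ (i g)^-1, j x] = u^-1 ^ (i g)^-1.
  apply: (canRL (conjgK (i g))); apply: (mulIg u).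
  by rewrite -group_commMgJ !mulVg comm1g.
rewrite {1}commgEl tx [[~ g, h]]commgEl iM group_commMgJ (nu_pairV nu_ij) uE -conjgM.
rewrite conjVg -(nu_pairV nu_ij) -iM -commgEl -ut conjgE.
by rewrite !invMg !invgK !mulgA.
Qed.

(** * The lower central series of nu(G) *)

Lemma comm_gen_sub (gT : finGroupType) (A B : {set gT}) (M : {group gT}) :
    A \subset 'N(M) -> B \subset 'N(M) ->
    (forall a b, a \in A -> b \in B -> [~ a, b] \in M) ->
  [~: <<A>>, <<B>>] \subset M.
Proof.
move=> nMA nMB sM; rewrite -quotient_cents2 ?gen_subG //.
rewrite (quotient_gen nMA) gen_subG /= (quotient_gen nMB) cent_gen quotient_cents2 // gen_subG.
by apply/subsetP=> _ /imset2P[a b Aa Bb ->]; apply: sM.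
Qed.

(* For p = 2 and p odd respectively: the exponent and the number of commutators
   in the definitions of potent group and of potently embedded subgroup. *)
Definition potent_exp p := if p == 2 then 4 else p.
Definition potent_len p := if p == 2 then 1%N else (p - 2)%N.

(** * Power commutators up to an error term, uniformly in p *)

Section PotentRemainder.
Variables (gT : finGroupType) (p : nat) (H : {group gT}).
Hypothesis p_pr : prime p.
Let q := potent_exp p.
Let l := potent_len p.
Implicit Types (A N : {group gT}) (B : {set gT}).

(* If it contains [N,_l H], then its last two factors can be dropped by
   nilpotency. For p odd the middle one is not needed to bound [x^p, y]. *)
Definition potent_error N :=
  power_subgroup q N <*>
    (power_subgroup p (iter_comm_group l N H) <*> iter_comm l.+1 N H).

Lemma potent_error_norm N : H \subset 'N(N) -> H \subset 'N(potent_error N).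
Proof. by move=> nNH; rewrite !normsY ?power_subgroup_norm ?iter_comm_norm. Qed.

Lemma commXg_potent N x y : N <| H -> x \in H -> y \in H ->
  [~ x, y] \in N -> [~ x ^+ q, y] \in potent_error N.
Proof.
move=> nsNH Hx Hy Nxy; rewrite /potent_error /q /l /potent_exp /potent_len.
case: eqP => [-> | p2]; first exact: commXg_four.
have -> : (p - 2).+1 = p.-1.
  by case: p p_pr p2 => [|[|[|k]]] // _ _; rewrite subn2.
have := commXg_prime p_pr nsNH Hx Hy Nxy; apply: subsetP.
by rewrite genS // setUS // joing_subr.
Qed.

Lemma comm_power_potent A B N : N <| H -> A \subset H -> B \subset H ->
  [~: A, B] \subset N -> [~: power_subgroup q A, B] \subset potent_error N.
Proof.
move=> nsNH sAH sBH sABN; have nMH := potent_error_norm (normal_norm nsNH).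
apply: (subset_trans (commgS _ (subset_gen B))); apply: comm_gen_sub.
- apply: subset_trans nMH; apply: subset_trans sAH.
  exact: subset_trans (subset_gen _) (power_subgroup_sub q A).
- exact: subset_trans nMH.
move=> _ b /imsetP[a Aa ->] Bb; apply: commXg_potent => //.
- exact: (subsetP sAH).
- exact: (subsetP sBH).
by rewrite (subsetP sABN) ?mem_commg.
Qed.

Lemma potent_error_absorb N : p.-group H -> N <| H ->
    iter_comm l N H \subset potent_error N ->
  iter_comm l N H \subset power_subgroup q N.
Proof.
move=> pH /andP[sNH nNH]; apply: sub_mod_power_comm pH _ _.
  rewrite /normal iter_comm_norm // andbT.
  exact: subset_trans (iter_comm_sub _ nNH) sNH.
exact: power_subgroup_norm.
Qed.

Lemma potently_embeddedI N : p.-group H -> N <| H ->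
    iter_comm l N H \subset potent_error N ->
  potently_embedded p N H.
Proof.
move=> pH nsNH /(potent_error_absorb pH nsNH); rewrite /q /l.
rewrite /potent_exp /potent_len => sN; split=> //; first exact: normal_sub.
by case: eqP sN => _ sN; apply: sN.
Qed.

(** The index [l.+1] is 2 for p = 2 and p - 1 for p odd, which merges the two cases of potency. *)
Lemma potent_lcn : potent p H -> 'L_(l.+1)(H) \subset power_subgroup q H.
Proof.
case=> _; rewrite /l /q /potent_len /potent_exp; case: eqP => // p2.
by case: p p_pr p2 => [|[|[|k]]] // _ _; rewrite subn2.
Qed.
End PotentRemainder.

Lemma iter_comm_lcn (gT : finGroupType) (H : {group gT}) n k :
  iter_comm n 'L_k.+1(H) H = 'L_(n + k).+1(H).
Proof. by elim: n => // n IH; rewrite iter_commS IH addSn lcnSn. Qed.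

(** * Tensor series and nilpotency of finite quotients of nu(G) *)

Section TensorSeries.
Variables (gT vT : finGroupType).
Implicit Types (i j : gT -> vT).

(** This is U_(n+1) = [gamma_(n+1)(X), Y]; index 0 gives the tensor square. *)
Definition lcn_tensor i j n := [~: i @: 'L_n.+1([set: gT]), j @: [set: gT]].

Lemma mem_lcn_tensor i j n a b : a \in 'L_n.+1([set: gT]) ->
  [~ i a, j b] \in lcn_tensor i j n.
Proof. by move=> La; rewrite mem_commg ?imset_f ?inE. Qed.

Lemma lcn_tensor_subS i j n : lcn_tensor i j n.+1 \subset lcn_tensor i j n.
Proof. by rewrite commSg // imsetS // lcn_subS. Qed.

(** Such an [H] is a finite quotient of nu(G), with [i] and [j] induced by the two canonical maps
    from G. *)
Definition nu_factor i j (H : {group vT}) : Prop :=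
  nu_pair i j /\ <<i @: [set: gT] :|: j @: [set: gT]>> = H.

Lemma nu_factor_sym i j H : nu_factor i j H -> nu_factor j i H.
Proof. by case=> nu_ij defH; split; [apply: nu_pair_sym | rewrite setUC]. Qed.

Lemma nu_factor_subl i j H : nu_factor i j H -> i @: [set: gT] \subset H.
Proof. by case=> _ <-; rewrite sub_gen ?subsetUl. Qed.

Lemma lcn_tensor_norm i j H n : nu_factor i j H -> H \subset 'N(lcn_tensor i j n).
Proof.
case=> [[_ _ ci cj]] <-; rewrite gen_subG; apply: norms_gen.
apply/subsetP=> _ /setUP[] /imsetP[k _ ->]; rewrite inE;
  apply/subsetP=> _ /imsetP[_ /imset2P[_ _ /imsetP[a La ->] /imsetP[b _ ->] ->] ->];
  by rewrite (ci, cj) imset2_f ?imset_f ?inE // memJ_norm // (subsetP (lcn_norm _ _)) ?inE.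
Qed.

Lemma lcn_tensor_sub i j H n : nu_factor i j H -> lcn_tensor i j n \subset H.
Proof.
move=> nu_ij; rewrite comm_subG ?(nu_factor_subl (nu_factor_sym nu_ij)) //.
exact: subset_trans (imsetS _ (lcn_sub _ _)) (nu_factor_subl nu_ij).
Qed.

(* x and x^phi act in the same way on tensors. *)
Lemma lcn_tensor_comm i j H n : nu_factor i j H ->
  [~: lcn_tensor i j n, H] \subset lcn_tensor i j n.+1.
Proof.
move=> nu_ij; have nMH := lcn_tensor_norm n.+1 nu_ij.
have sTH := lcn_tensor_sub n nu_ij.
have [nuij defH] := nu_ij; have [_ _ ci cj] := nuij.
rewrite -{1}defH; apply: comm_gen_sub.
- by apply: subset_trans nMH; apply: subset_trans sTH; apply: subset_gen.
- by rewrite -gen_subG defH.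
move=> _ y /imset2P[_ _ /imsetP[a La ->] /imsetP[b _ ->] ->].
have Lab x : [~ [~ i a, j b], j x] \in lcn_tensor i j n.+1.
  by rewrite tensor_commE // mem_lcn_tensor // lcnSn mem_commg ?inE.
case/setUP=> /imsetP[x _ ->] //.
by rewrite commgEl ci -cj -commgEl.
Qed.

Lemma iter_comm_lcn_tensor i j (H : {group vT}) n : nu_factor i j H ->
  iter_comm n [~: i @: [set: gT], j @: [set: gT]] H \subset lcn_tensor i j n.
Proof.
move=> nu_ij; elim: n => // n IH; rewrite iter_commS.
exact: subset_trans (commSg _ IH) (lcn_tensor_comm n nu_ij).
Qed.

(** An upper bound for gamma_(n+1)(H): a tensor in [gamma_n(X), Y] has weight n + 1, whence [n.-1].
    At n = 0 the predecessor just gives all tensors. *)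
Definition lcn_nu i j n :=
  <<(i @: 'L_n.+1([set: gT]) :|: j @: 'L_n.+1([set: gT]))
    :|: (lcn_tensor i j n.-1 :|: lcn_tensor j i n.-1)>>.

Lemma lcn_nu_mem i j n x :
    [|| x \in i @: 'L_n.+1([set: gT]), x \in j @: 'L_n.+1([set: gT]),
        x \in lcn_tensor i j n.-1 | x \in lcn_tensor j i n.-1] ->
  x \in lcn_nu i j n.
Proof. by move=> x_in; rewrite mem_gen // !inE -!orbA. Qed.

Lemma lcn_nu_sym i j n : lcn_nu j i n = lcn_nu i j n.
Proof. by rewrite /lcn_nu [j @: _ :|: _]setUC [lcn_tensor j i _ :|: _]setUC. Qed.

Lemma lcn_nu_norm i j H n : nu_factor i j H -> H \subset 'N(lcn_nu i j n).
Proof.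
move=> nu_ij; have nu_ji := nu_factor_sym nu_ij.
have nD k l a g : nu_factor k l H -> a \in 'L_n.+1([set: gT]) ->
    k a ^ k g \in lcn_nu k l n /\ k a ^ l g \in lcn_nu k l n.
  case=> nu_kl _ La; split.
    rewrite -(nu_pairJ nu_kl) lcn_nu_mem // imset_f // memJ_norm //.
    by rewrite (subsetP (lcn_norm _ _)) ?inE.
  (* Conjugation by the other copy multiplies [k a] by a tensor already contained in the bound. *)
  rewrite conjg_mulR groupM // lcn_nu_mem ?imset_f //.
  have := mem_lcn_tensor k l g La; case: (n) => [|m] /= T; first by rewrite T !orbT.
  by rewrite (subsetP (lcn_tensor_subS _ _ _)) ?orbT.
have HXY : <<i @: [set: gT] :|: j @: [set: gT]>> = H by case: nu_ij.
rewrite -{1}HXY gen_subG; apply/subsetP=> y Sy; rewrite inE -genJ gen_subG.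
have Hy : y \in H by rewrite -HXY mem_gen.
apply/subsetP=> _ /imsetP[s Ss ->].
case/setUP: Ss => /setUP[] Ss.
- case/imsetP: Ss => a La ->.
  by case/setUP: Sy => /imsetP[g _ ->]; have [] := nD i j a g nu_ij La.
- case/imsetP: Ss => a La ->.
  by case/setUP: Sy => /imsetP[g _ ->]; have := nD j i a g nu_ji La;
     rewrite lcn_nu_sym => -[].
- have nTy := subsetP (lcn_tensor_norm n.-1 nu_ij) y Hy.
  by apply: lcn_nu_mem; rewrite (memJ_norm s nTy) Ss ?orbT.
- have nTy := subsetP (lcn_tensor_norm n.-1 nu_ji) y Hy.
  by apply: lcn_nu_mem; rewrite (memJ_norm s nTy) Ss ?orbT.
Qed.

(** Commuting a generator of the bound with one of [H] stays in the same copy, gives a tensor of the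
    next weight, or moves a tensor one step down its series. *)
Lemma lcn_sub_nu i j H n : nu_factor i j H -> 'L_n.+1(H) \subset lcn_nu i j n.
Proof.
move=> nu_ij; have nu_ji := nu_factor_sym nu_ij.
have [nuij HXY] := nu_ij; have [iM jM _ _] := nuij.
elim: n => [|n IH].
  by rewrite lcn1 -HXY genS // subsetU // setUS.
rewrite lcnSn; apply: subset_trans (commSg H IH) _.
have nMH := lcn_nu_norm n.+1 nu_ij.
rewrite -{1}HXY; apply: comm_gen_sub.
- apply: subset_trans nMH; rewrite !subUset !lcn_tensor_sub //.
  have sL : 'L_n.+1([set: gT]) \subset [set: gT] by [].
  rewrite (subset_trans (imsetS _ sL)) ?(nu_factor_subl nu_ij) //.
  by rewrite (subset_trans (imsetS _ sL)) ?(nu_factor_subl nu_ji).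
- by rewrite -gen_subG HXY.
have tensor_in k l m y : nu_factor k l H -> y \in lcn_tensor k l m.-1 ->
    forall z, z \in H -> [~ y, z] \in lcn_tensor k l m.
  (* For [m = 0] the predecessor does not lower the index, and normality is enough. *)
  move=> nu_kl Ty z Hz; case: m Ty => [|m] Ty.
    rewrite commgEl groupM ?groupV // memJ_norm //.
    by rewrite (subsetP (lcn_tensor_norm _ nu_kl)).
  by rewrite (subsetP (lcn_tensor_comm _ nu_kl)) ?mem_commg.
move=> y z Sy Sz; have Hz : z \in H by rewrite -HXY mem_gen.
have Lab a b : a \in 'L_n.+1([set: gT]) -> [~ a, b] \in 'L_n.+2([set: gT]).
  by move=> La; rewrite lcnSn mem_commg ?inE.
apply: lcn_nu_mem => /=; case/setUP: Sy => /setUP[] Sy.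
- case/imsetP: Sy => a La ->; case/setUP: Sz => /imsetP[b _ ->].
    by rewrite -(nu_pairR nuij) imset_f ?Lab.
  by rewrite mem_lcn_tensor ?orbT.
- case/imsetP: Sy => a La ->; case/setUP: Sz => /imsetP[b _ ->].
    by rewrite mem_lcn_tensor ?orbT.
  by rewrite -(nu_pairR (nu_pair_sym nuij)) imset_f ?Lab ?orbT.
- by rewrite (tensor_in i j) ?orbT.
- by rewrite (tensor_in j i) ?orbT.
Qed.

Lemma nu_factor_nilpotent i j H :
  nu_factor i j H -> nilpotent [set: gT] -> nilpotent H.
Proof.
move=> nu_ij /lcnP[c Lc]; have [nuij _] := nu_ij.
have [i1 j1] := (nu_pair1 nuij, nu_pair1 (nu_pair_sym nuij)).
have Lc1 : 'L_c.+2([set: gT]) = 1 by rewrite lcnSn Lc comm1G.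
(* The tensor part of [lcn_nu] lags one term behind the lower central series of G, which costs one
   extra step. *)
apply/lcnP; exists c.+1; apply/trivgP.
apply: subset_trans (lcn_sub_nu c.+1 nu_ij) _.
rewrite /lcn_nu /lcn_tensor /= Lc Lc1 !imset_set1 i1 j1 !comm1G.
by rewrite gen_subG !setUid.
Qed.

(** The generators of [H] are images of p-elements, and in a nilpotent group all p-elements lie in
    ['O_p(H)]. *)
Lemma nu_factor_pgroup (p : nat) i j H :
  nu_factor i j H -> p.-group [set: gT] -> p.-group H.
Proof.
move=> nu_ij pG; have nilH := nu_factor_nilpotent nu_ij (pgroup_nil pG).
have pX k l : nu_factor k l H -> k @: [set: gT] \subset 'O_p(H).
  move=> nu_kl; apply/subsetP=> _ /imsetP[g _ ->].
  rewrite (mem_normal_Hall (nilpotent_pcore_Hall p nilH) (pcore_normal _ _)).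
    rewrite /p_elt; apply: (pnat_dvd (m := #[k g]) _ (mem_p_elt pG (in_setT g))).
    by rewrite order_dvdn -(nu_pairX nu_kl.1) expg_order (nu_pair1 nu_kl.1).
  by rewrite (subsetP (nu_factor_subl nu_kl)) ?imset_f ?inE.
apply: pgroupS (pcore_pgroup p H); rewrite -{1}nu_ij.2 gen_subG subUset.
by rewrite (pX i j) ?(pX j i) //; apply: nu_factor_sym.
Qed.
End TensorSeries.

(** * Potent embedding of the tensor square and of the lower central terms *)

Section PotentFactors.
Variables (gT vT : finGroupType).
Implicit Types (i j : gT -> vT) (H : {group vT}).

Lemma nu_pair_imsetR i j (A B : {set gT}) :
  nu_pair i j -> i @: [~: A, B] = [~: i @: A, i @: B].
Proof.
case=> iM _ _ _; pose f := Morphism (D := [set: gT]) (in2W iM).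
by rewrite -!(morphimEsub f) ?subsetT // morphimR ?subsetT.
Qed.

Lemma nu_pair_power i j (K : {group vT}) m :
    nu_pair i j -> i @: [set: gT] \subset K ->
  i @: power_subgroup m [set: gT] \subset power_subgroup m K.
Proof.
case=> iM _ _ _ sXK; pose f := Morphism (D := [set: gT]) (in2W iM).
rewrite -(morphimEsub f) ?subsetT // morphim_gen ?subsetT // gen_subG.
apply/subsetP=> _ /morphimP[_ _ /imsetP[a _ ->] ->].
by rewrite morphX ?inE // power_subgroupP // (subsetP sXK) ?imset_f ?inE.
Qed.

(** [K] is left free: it will be the image of G for the tensor square and all of [H] for the lower
    central series. *)
Lemma nu_pair_lcn_pow p i j (K : {group vT}) : prime p -> nu_pair i j ->
    potent p [set: gT] -> i @: [set: gT] \subset K ->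
  i @: 'L_(potent_len p).+1([set: gT]) \subset power_subgroup (potent_exp p) K.
Proof.
move=> p_pr nu_ij /(potent_lcn p_pr) potG sXK.
exact: subset_trans (imsetS _ potG) (nu_pair_power _ nu_ij sXK).
Qed.

Lemma tensor_potently_embedded p i j H : prime p -> nu_factor i j H ->
    potent p [set: gT] ->
  potently_embedded p [~: i @: [set: gT], j @: [set: gT]] H.
Proof.
move=> p_pr nu_ij potG; have pH := nu_factor_pgroup nu_ij potG.1.
have [nuij _] := nu_ij; have [iM _ _ _] := nuij.
have nsTH : [~: i @: [set: gT], j @: [set: gT]] <| H.
  by rewrite /normal (lcn_tensor_sub 0 nu_ij) (lcn_tensor_norm 0 nu_ij).
apply: potently_embeddedI => //.
apply: subset_trans (iter_comm_lcn_tensor _ nu_ij) _.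
pose f := Morphism (D := [set: gT]) (in2W iM).
have fX : f @* [set: gT] = i @: [set: gT] by rewrite morphimEsub.
(* Powers are taken inside X rather than [H], since [comm_power_potent] must start from [X, Y], the
   tensor square itself. *)
have powX := nu_pair_lcn_pow (K := (f @* [set: gT])%G) p_pr nuij potG.
apply: subset_trans (commSg _ (powX _)) _; first by rewrite /= fX.
apply: comm_power_potent => //=; rewrite ?fX ?(nu_factor_subl nu_ij) //.
exact: nu_factor_subl (nu_factor_sym nu_ij).
Qed.

(** Each of the four pieces of [lcn_nu] is here a commutator whose left entry is the image of
    gamma_(l+1)(G), with l = [potent_len p], and potency puts that image in the q-th powers, q =
    [potent_exp p]. *)
Lemma nu_factor_lcn_comm_pow p i j H : prime p -> nu_factor i j H ->
    potent p [set: gT] ->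
  'L_(potent_len p).+2(H) \subset [~: power_subgroup (potent_exp p) H, H].
Proof.
move=> p_pr nu_ij potG.
have len_gt0 : 0 < potent_len p.
  rewrite /potent_len; case: eqP => // p2.
  by case: p p_pr p2 {potG} => [|[|[|k]]] // _ _; rewrite subn2.
have sLP k l : nu_factor k l H ->
    k @: 'L_(potent_len p).+1([set: gT]) \subset power_subgroup (potent_exp p) H.
  by move=> nu_kl; apply: nu_pair_lcn_pow p_pr nu_kl.1 potG (nu_factor_subl nu_kl).
have sub k l : nu_factor k l H ->
    (k @: 'L_(potent_len p).+2([set: gT]) \subset
       [~: power_subgroup (potent_exp p) H, H])
    /\ (lcn_tensor k l (potent_len p) \subset
       [~: power_subgroup (potent_exp p) H, H]).
  move=> nu_kl; have sXH := nu_factor_subl nu_kl.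
  have sYH := nu_factor_subl (nu_factor_sym nu_kl).
  split; last by rewrite commgSS // (sLP k l).
  by rewrite lcnSn (nu_pair_imsetR _ _ nu_kl.1) commgSS // (sLP k l).
have [[sX sT] [sY sT']] := (sub i j nu_ij, sub j i (nu_factor_sym nu_ij)).
apply: subset_trans (lcn_sub_nu _ nu_ij) _.
by rewrite gen_subG !subUset sX sY sT sT'.
Qed.

Lemma lcn_potently_embedded p i j H k : prime p -> nu_factor i j H ->
    potent p [set: gT] -> 2 <= k ->
  potently_embedded p 'L_k(H) H.
Proof.
move=> p_pr nu_ij potG; case: k => [|[|k]] // _.
have pH := nu_factor_pgroup nu_ij potG.1.
set q := potent_exp p; set l := potent_len p.
suff: iter_comm l 'L_k.+2(H) H \subset potent_error p H 'L_k.+2(H).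
  by apply: potently_embeddedI => //; apply: lcn_normal.
have step n : [~: power_subgroup q 'L_n.+1(H), H] \subset
    potent_error p H 'L_n.+2(H).
  by apply: comm_power_potent; rewrite ?lcn_normal ?lcn_sub // lcnSn.
elim: k => [|k IH]; rewrite iter_comm_lcn.
  by rewrite addn1; apply: subset_trans (nu_factor_lcn_comm_pow p_pr nu_ij potG) (step 0).
(* Absorbing the error first turns the induction hypothesis into a bound by q-th powers of
   ['L_k.+2(H)], to which [step] applies. *)
rewrite addnS lcnSn -iter_comm_lcn; apply: subset_trans (step k.+1).
by rewrite commSg // potent_error_absorb // lcn_normal.
Qed.

End PotentFactors.

(** * Finiteness of nu(G) *)

Section FiniteNormalSubgroups.
Variable V : groupType.
Implicit Types (S : V -> Prop) (x y z s t : V).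

(** Finite normal subgroups of a possibly infinite group, as predicates; finiteness is a covering
    list. *)
Record fin_normal S : Prop := FinNormal {
  fin_normal1 : S 1;
  fin_normalM : forall x y, S x -> S y -> S (x * y);
  fin_normalV : forall x, S x -> S x^-1;
  fin_normalJ : forall x y, S x -> S (x ^ y);
  fin_normal_fin : exists l : seq V, forall x, S x -> x \in l }.

Lemma fin_normalX S x n : fin_normal S -> S x -> S (x ^+ n).
Proof.
by case=> S1 SM _ _ _ Sx; elim: n => [|n IH]; rewrite ?expgS //; apply: SM.
Qed.

Lemma fin_normal_expMg S x s k :
  fin_normal S -> S s -> exists2 t, S t & (x * s) ^+ k = x ^+ k * t.
Proof.
case=> S1 SM _ SJ _ Ss; elim: k => [|k [t St IH]]; first by exists 1; rewrite ?mulg1.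
exists (t ^ x * s); first by apply: SM => //; apply: SJ.
by rewrite !expgSr IH -!mulgA mulKVg.
Qed.

(* The witness is the group of all z ^+ k * s with s in S. *)
Lemma fin_normal_adjoin S z n :
    fin_normal S -> 0 < n -> S (z ^+ n) -> (forall y, S [~ z, y]) ->
  exists T, [/\ fin_normal T, T z & forall x, S x -> T x].
Proof.
move=> fnS n_gt0 Szn Sz; have [S1 SM SV SJ [l Sl]] := fnS.
exists (fun x => exists k, exists2 s, S s & x = z ^+ k * s); split; first split.
- by exists 0%N, 1; rewrite ?mulg1.
- move=> _ _ [k [s Ss ->]] [m [t St ->]]; exists (k + m)%N, (s ^ (z ^+ m) * t).
    by apply: SM => //; apply: SJ.
  by rewrite expgnDr -!mulgA mulKVg.
(* To keep the exponent natural, z^-k is written as z^(nk-k) z^(-nk), whose last factor lies in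
   [S]. *)
- move=> _ [k [s Ss ->]]; exists (n * k - k)%N.
  exists (((z ^+ n ^+ k)^-1 * s^-1) ^ (z ^+ k)^-1).
    by apply: SJ; apply: SM; apply: SV => //; apply: fin_normalX.
  rewrite expgnFr ?leq_pmull // expgnA invMg conjgE invgK.
  by rewrite -!mulgA mulKg mulKVg.
- move=> _ y [k [s Ss ->]]; have [t St zt] := fin_normal_expMg z k fnS (Sz y).
  exists k, (t * s ^ y); first by apply: SM => //; apply: SJ.
  have zy : (z ^ y) ^+ k = z ^+ k * t by rewrite -zt commgEl mulKVg.
  by rewrite conjMg conjXg zy (mulgA (z ^+ k)).
- exists [seq z ^+ k * s | k <- iota 0 n, s <- l] => _ [k [s Ss ->]].
  rewrite (divn_eq k n) addnC expgnDr mulnC expgnA -mulgA.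
  apply: allpairs_f; first by rewrite mem_iota ltn_mod.
  by apply/Sl/SM => //; apply: fin_normalX.
- by exists 1%N, 1; rewrite ?mulg1.
- by move=> x Sx; exists 0%N, x; rewrite ?mul1g.
Qed.

Lemma fin_normal_adjoin_seq S (r : seq V) :
    fin_normal S ->
    (forall z, z \in r ->
       (exists2 n, 0 < n & S (z ^+ n)) /\ forall y, S [~ z, y]) ->
  exists T, [/\ fin_normal T, forall z, z \in r -> T z & forall x, S x -> T x].
Proof.
elim: r S => [|z r IH] S fnS Sr; first by exists S.
have [[n n_gt0 Szn] Sz] := Sr z (mem_head z r).
have [T [fnT Tz ST]] := fin_normal_adjoin fnS n_gt0 Szn Sz.
have [x xr|U [fnU Ur TU]] := IH T fnT.
  have [[m m_gt0 Sxm] Sx] := Sr x (mem_behead (s := z :: r) xr).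
  by split=> [|y]; [exists m => //; apply: ST | apply: ST].
exists U; split=> // [x|x Sx]; last exact/TU/ST.
by rewrite inE => /predU1P[-> | /Ur//]; apply: TU.
Qed.
End FiniteNormalSubgroups.

Lemma nu_ind (G : groupType) (P : nu G -> Prop) :
    P 1 -> (forall x y, P x -> P y -> P (x * y)) -> (forall x, P x -> P x^-1) ->
    (forall g, P (nu_G g)) -> (forall g, P (nu_Gphi g)) ->
  forall x, P x.
Proof.
move=> P1 PM PV PG PGphi x; rewrite -(presented_reprK x).
elim: (generic_quotient.repr x) => [[g|g]||u Pu v Pv|u Pu].
- exact: PG.
- exact: PGphi.
- exact: P1.
- by rewrite [presented_pi _ _](presented_piM _ u v); apply: PM.
- by rewrite [presented_pi _ _](presented_piV _ u); apply: PV.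
Qed.

Lemma nu_pair_nu (G : groupType) : nu_pair (@nu_G G) (@nu_Gphi G).
Proof.
have piM u v : presented_pi (@nu_rel G) (u * v) =
    presented_pi (@nu_rel G) u * presented_pi (@nu_rel G) v :> nu G.
  exact: presented_piM.
have piV u : presented_pi (@nu_rel G) u^-1 =
    (presented_pi (@nu_rel G) u)^-1 :> nu G.
  exact: presented_piV.
have piR u v : presented_pi (@nu_rel G) [~ u, v] =
    [~ presented_pi (@nu_rel G) u, presented_pi (@nu_rel G) v] :> nu G.
  by rewrite /commg /conjg !piM !piV.
have piJ u v : presented_pi (@nu_rel G) (u ^ v) =
    presented_pi (@nu_rel G) u ^ presented_pi (@nu_rel G) v :> nu G.
  by rewrite /conjg !piM !piV.
split=> [g h|g h|g h k|g h k].
- by rewrite -piM; apply/presented_piP/word_eq_rel; constructor.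
- by rewrite -piM; apply/presented_piP/word_eq_rel; constructor.
- by rewrite -!piR -piJ; apply/presented_piP/word_eq_rel; constructor.
- by rewrite -!piR -piJ; apply/presented_piP/word_eq_rel; constructor.
Qed.

(* The tensors are adjoined one by one to a finite normal subgroup, those on
   'L_n after those on 'L_n.+1, modulo which they are central. *)
Lemma nu_finite (gT : finGroupType) :
  nilpotent [set: gT] -> exists l : seq (nu gT), forall x, x \in l.
Proof.
case/lcnP=> c Lc.
have nu_ij := nu_pair_nu gT; have nu_ji := nu_pair_sym nu_ij.
set i := @nu_G gT in nu_ij nu_ji; set j := @nu_Gphi gT in nu_ij nu_ji.
have [iM jM ci cj] := nu_ij.
have fin_tensor d : d <= c -> exists S, fin_normal S /\
    forall a b, a \in 'L_(c.+1 - d)([set: gT]) -> S [~ i a, j b].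
  elim: d => [|d IH] le_dc.
    exists (fun x => x = 1); split.
      split=> // [x y -> ->|x ->|x y ->|]; rewrite ?mulg1 ?invg1 ?conj1g //.
      by exists [:: 1] => x ->; rewrite inE.
    by move=> a b; rewrite subn0 Lc => /set1P->; rewrite (nu_pair1 nu_ij) comm1g.
  have [S [fnS St]] := IH (ltnW le_dc); have [S1 SM SV SJ _] := fnS.
  set L := 'L_(_)([set: gT]).
  have LS a b : a \in L -> [~ a, b] \in 'L_(c.+1 - d)([set: gT]).
    move=> La; have -> : (c.+1 - d = (c.+1 - d.+1).+1)%N by rewrite subSS subSn // ltnW.
    by apply: (subsetP (lcnSnS _ _)); rewrite mem_commg ?inE.
  pose r := [seq [~ i a, j b] | a <- enum L, b <- enum gT].
  have Sr z : z \in r ->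
      (exists2 n, 0 < n & S (z ^+ n)) /\ forall y, S [~ z, y].
    case/allpairsP=> -[a b] /= [La _ ->]; rewrite mem_enum in La.
    have Sz y : S [~ [~ i a, j b], y].
      have Sj x : S [~ [~ i a, j b], j x].
        by rewrite tensor_commE //; apply/St/LS.
      elim/nu_ind: y => [|x y Sx Sy|x Sx|x|x]; rewrite ?commg1 //.
      - by rewrite group_commgMJ; apply: SM => //; apply: SJ.
      - have /eqP : [~ [~ i a, j b], x^-1] * [~ [~ i a, j b], x] ^ x^-1 = 1.
          by rewrite -group_commgMJ mulgV commg1.
        by rewrite mulg_eq1 => /eqP->; apply: SV; apply: SJ.
      - by rewrite commgEl ci -cj -commgEl.
    (* As [[~ i a, j b]] is central modulo [S], its k-th power is [[~ i (a ^+ k), j b]] there, which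
       is 1 for k = [#[a]]. *)
    split=> //; exists #[a] => //.
    have [t St1] : exists2 t, S t & [~ i (a ^+ #[a]), j b] = [~ i a, j b] ^+ #[a] * t.
      elim: #[a] => [|k [t St1 IHk]].
        by exists 1; rewrite // (nu_pair1 nu_ij) comm1g mulg1.
      have [s Ss zs] := fin_normal_expMg [~ i a, j b] k fnS (Sz (i a)).
      exists ((s * t ^ i a) ^ [~ i a, j b]); first by apply: (SJ); apply: SM => //; apply: SJ.
      rewrite [a ^+ _]expgSr iM group_commMgJ IHk (conjMg _ t) conjXg.
      have -> : [~ i a, j b] ^ i a = [~ i a, j b] * [~ [~ i a, j b], i a].
        by rewrite [in RHS]commgEl mulKVg.
      rewrite zs expgSr; move: [~ i a, j b] (t ^ i a) => w u.
      by rewrite /conjg !mulgA mulgK.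
    rewrite expg_order (nu_pair1 nu_ij) comm1g => /esym/(canRL (mulgK t)).
    by rewrite mul1g => ->; apply: SV.
  have [T [fnT rT _]] := fin_normal_adjoin_seq fnS Sr.
  by exists T; split=> // a b La; apply/rT/allpairs_f; rewrite mem_enum.
have [S [[S1 SM SV SJ [l Sl]] St]] := fin_tensor c (leqnn c).
rewrite subSnn lcn1 in St.
have {}St a b : S [~ i a, j b] by apply: St; rewrite inE.
have St' a b : S [~ j b, i a] by rewrite -invgR; apply: SV.
(* Now [S] contains all tensors, so sorting a word into [i g * j h] costs only a factor from [S]. *)
exists [seq x * s | x <- [seq i g * j h | g <- enum gT, h <- enum gT], s <- l].
move=> x; suff [g [h [s Ss ->]]] : exists g h, exists2 s, S s & x = i g * j h * s.
  by apply: allpairs_f; [apply: allpairs_f; rewrite mem_enum | apply: Sl].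
elim/nu_ind: x => [|_ _ [g [h [s Ss ->]]] [g' [h' [s' Ss' ->]]]|_ [g [h [s Ss ->]]]|g|g].
- by exists 1, 1, 1; rewrite // (nu_pair1 nu_ij) (nu_pair1 nu_ji) !mulg1.
- exists (g * g'), (h * h'), ([~ j h, i g'] ^ j h' * s ^ (i g' * j h') * s').
    by apply: (SM) => //; apply: SM; apply: SJ.
  rewrite iM jM -!mulgA; congr (_ * _).
  rewrite !mulgA; congr (_ * _).
  by rewrite -!mulgA !mulKVg (mulgA (i g') (j h')) mulKVg.
- exists g^-1, h^-1, ([~ j h^-1, i g^-1] * s^-1 ^ (j h^-1 * i g^-1)).
    by apply: SM => //; apply: SJ; apply: SV.
  rewrite (mulgA (i _ * j _)) -commgC -conjgC (nu_pairV nu_ij) (nu_pairV nu_ji).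
  by rewrite !invMg.
- by exists g, 1, 1; rewrite // (nu_pair1 nu_ji) !mulg1.
- by exists 1, g, 1; rewrite // (nu_pair1 nu_ij) mul1g mulg1.
Qed.

(** A copy of [V] that remembers [lP], so that [l] can supply the finite structure; the group law is
    unchanged and the isomorphism is the identity. *)
Definition enumerated_group (V : groupType) (l : seq V) of (forall x, x \in l)
  : Type := V.

Section EnumeratedGroup.
Variables (V : groupType) (l : seq V) (lP : forall x, x \in l).
Local Notation E := (enumerated_group lP).

HB.instance Definition _ := Group.on E.

Lemma enumerated_pickleK :
  pcancel (index^~ l : E -> nat) (fun n => ohead (drop n l)).
Proof.
move=> x; have lt_x : index x l < size l by rewrite index_mem.
by rewrite (drop_nth 1) //= nth_index.
Qed.
HB.instance Definition _ := isCountable.Build E enumerated_pickleK.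

Lemma enumerated_axiom : Finite.axiom (undup l : seq E).
Proof. by move=> x; rewrite count_uniq_mem ?undup_uniq // mem_undup lP. Qed.
HB.instance Definition _ := isFinite.Build E enumerated_axiom.

Definition to_enumerated : V -> E := id.
HB.instance Definition _ :=
  isMultiplicative.Build V E to_enumerated (fun _ _ => erefl).
End EnumeratedGroup.

Theorem theoremA (p : nat) (gT : finGroupType) :
  prime p ->
  potent p [set: gT] ->
  exists (vT : finGroupType) (f : {multiplicative nu gT -> vT}),
    [/\ bijective f,
        potently_embedded p
          [~: [set f (nu_G g) | g : gT], [set f (nu_Gphi h) | h : gT]]
          [set: vT]
      & forall k : nat, (2 <= k)%N ->
        potently_embedded p 'L_k([set: vT]) [set: vT]].
Proof.
move=> p_pr potG; have [l lP] := nu_finite (pgroup_nil potG.1).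
pose f := to_enumerated lP; exists (enumerated_group lP), f.
have nu_ij := nu_pair_nu gT.
have fact : nu_factor (f \o @nu_G gT) (f \o @nu_Gphi gT) [set: enumerated_group lP].
  (* The relations carry over along the identity; generation is induction on words. *)
  split=> //; apply/setP=> x; rewrite inE; set S := _ :|: _.
  elim/(@nu_ind gT): x => [|x y Sx Sy|x Sx|g|g].
  - exact: group1.
  - exact: groupM.
  - by apply/groupVr.
  - by rewrite mem_gen // inE; apply/orP; left; apply: (imset_f (f \o _)).
  - by rewrite mem_gen // inE; apply/orP; right; apply: (imset_f (f \o _)).
split; [by exists id | | by move=> k; apply: lcn_potently_embedded fact potG].
have -> : [set f (nu_G g) | g : gT] = (f \o @nu_G gT) @: [set: gT].
  by apply/setP=> x; apply/imsetP/imsetP=> -[g _ ->]; exists g.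
have -> : [set f (nu_Gphi g) | g : gT] = (f \o @nu_Gphi gT) @: [set: gT].
  by apply/setP=> x; apply/imsetP/imsetP=> -[g _ ->]; exists g.
exact: tensor_potently_embedded fact potG.
Qed.
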